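(* Let $\alpha=(\alpha_1,\dots,\alpha_m)$ be a normalized score vector. There is an algorithm solving the $(\epsilon,\delta)$-winner determination problem for the $\alpha$-scoring rule with sample complexity $O\!\left(\frac{\log(m/\delta)}{\epsilon^2}\right)$.
   Context: An election has $n$ voters and $m$ candidates, each vote a complete linear order over the candidates. A score vector $\alpha\in\mathbb{R}^m$ satisfies $\alpha_1\ge\dots\ge\alpha_m$, $\alpha_1>\alpha_m$; it is normalized if there is $j$ with $\alpha_j=1$ and $\alpha_k=0$ for all $k>j$. Under the $\alpha$-scoring rule a candidate at position $i$ of a vote receives $\alpha_i$ from it; the candidate with maximum total score wins (ties broken by an arbitrary fixed rule). The margin of victory (MOV) is the smallest number of votes that must be changed (others kept unchanged) to change the winner. The $(\epsilon,\delta)$-winner determination problem: given the $n$ votes with MOV at least $\epsilon n$, output the winner with probability at least $1-\delta$ over the algorithm's internal randomness; the algorithm may query full votes of arbitrary voters, and the sample complexity is the number of queried votes. *)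

(* Defs.v *)
From HB Require Import structures.
From mathcomp Require Import all_boot all_order all_algebra all_fingroup.
From mathcomp Require Import reals exp.

Set Implicit Arguments.
Unset Strict Implicit.
Unset Printing Implicit Defensive.
Import Order.TTheory GRing.Theory Num.Theory.
Local Open Scope ring_scope.

(* A linear order over the candidates 'I_m is given by its ranking: [v c] is
   the position of [c] in [v], counted from 0 (the most preferred). *)
Definition vote (m : nat) := {perm 'I_m}.

Definition profile (n m : nat) := {ffun 'I_n -> vote m}.

(* The entry [a ord0 i] is the score of position i, i.e. $\alpha_{i+1}$.
   The second clause is $\alpha_1 > \alpha_m$; it forces 2 <= m. *)
Definition score_vector (R : realType) (m : nat) (a : 'rV[R]_m) : Prop :=
  (forall i j : 'I_m, (i <= j)%N -> a ord0 j <= a ord0 i) /\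
  (exists i j : 'I_m,
      [/\ i = 0%N :> nat, j = m.-1 :> nat & a ord0 j < a ord0 i]).

Definition normalized (R : realType) (m : nat) (a : 'rV[R]_m) : Prop :=
  exists j : 'I_m,
    a ord0 j = 1 /\ (forall k : 'I_m, (j < k)%N -> a ord0 k = 0).

Section Election.
Variables (R : realType) (n m : nat) (a : 'rV[R]_m).
Implicit Types (P Q : profile n m) (c : 'I_m).

Definition score P c : R := \sum_(i < n) a ord0 (P i c).

Definition top_scorers P : {set 'I_m} :=
  [set c | [forall d, score P d <= score P c]].

(* Which of the tied candidates is selected may depend on the whole election,
   so that no particular kind of deterministic rule is favoured. *)
Definition tie_breaking_rule (tb : profile n m -> {set 'I_m} -> 'I_m) : Prop :=
  forall P (T : {set 'I_m}), T != set0 -> tb P T \in T.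

Variable tb : profile n m -> {set 'I_m} -> 'I_m.

Definition winner P : 'I_m := tb P (top_scorers P).

Definition changed_votes P Q : nat := #|[set i | P i != Q i]|.

(* The default value n is an upper bound of all the terms, so this is their
   minimum as soon as some Q has another winner, which is always the case for
   a score vector and 0 < n (rank the winner last in every vote). *)
Definition margin_of_victory P : nat :=
  \big[minn/n]_(Q : profile n m | winner Q != winner P) changed_votes P Q.

End Election.

(* Randomized adaptive query algorithms: [Query i k] reads the full vote v of
   voter i and continues as [k v]; [Draw b k] draws j uniformly from the b.+1
   elements of 'I_b.+1, independently of the past, and continues as [k j]. *)
Inductive algorithm (n m : nat) : Type :=
| Output of 'I_m
| Query of 'I_n & (vote m -> algorithm n m)
| Draw (b : nat) of ('I_b.+1 -> algorithm n m).

Section Algorithm.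
Variables (n m : nat).
Implicit Types (A : algorithm n m) (P : profile n m) (c : 'I_m).

(* Probability, over the draws of A, that A run on the votes P outputs c. *)
Fixpoint output_prob (R : realType) A P c : R :=
  match A with
  | Output d => (d == c)%:R
  | Query i k => output_prob R (k (P i)) P c
  | Draw b k => (\sum_(j < b.+1) output_prob R (k j) P c) / b.+1%:R
  end.

(* Number of queries of A run on P, for the worst outcome of the draws; a voter
   queried several times is counted as many times. *)
Fixpoint queries A P : nat :=
  match A with
  | Output _ => 0
  | Query i k => (queries (k (P i)) P).+1
  | Draw b k => \max_(j < b.+1) queries (k j) P
  end.

Definition sample_complexity A : nat := \max_(P : profile n m) queries A P.

Definition solves_winner_determination (R : realType) (a : 'rV[R]_m)
    (tb : profile n m -> {set 'I_m} -> 'I_m) (eps delta : R) A : Prop :=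
  forall P, eps * n%:R <= (margin_of_victory a tb P)%:R ->
    1 - delta <= output_prob R A P (winner a tb P).

End Algorithm.

(* Main.v *)
(* The gap between the winner w and any other candidate x is at least
   (MOV - 1) D, where D = a_1 - a_m: otherwise one can pick MOV - 1 votes in
   which w is altogether at least as good as x, and rank x first and w last in
   each of them, which puts x strictly ahead of w.  So as soon as eps n > 2, the
   average of the gap over the voters is at least (eps / 2) D, while each voter
   contributes a term in [-D, D].  Sampling voters uniformly with replacement
   and returning the best candidate of the sample then succeeds by a Chernoff
   bound and a union bound over the candidates x.  If eps n <= 2, there are few
   enough voters to query all of them. *)

Require Import Defs.
From HB Require Import structures.
From mathcomp Require Import all_boot all_order all_algebra all_fingroup.
From mathcomp Require Import reals exp.
From mathcomp Require Import sequences ring lra.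
Set Implicit Arguments.
Unset Strict Implicit.
Unset Printing Implicit Defensive.
Import Order.TTheory GRing.Theory Num.Theory.
Local Open Scope ring_scope.

(** * Subset sums, exponential bounds and a permutation *)

(** Shrink the full set one element at a time: remove a nonpositive term if there is one; otherwise
    all terms are positive and any removal leaves a nonnegative sum. *)
Lemma nonneg_subset_sum (R : realDomainType) (I : finType) (g : I -> R)
    (k : nat) :
  (k <= #|I|)%N -> 0 <= \sum_i g i ->
  exists S : {set I}, #|S| = k /\ 0 <= \sum_(i in S) g i.
Proof.
move=> le_k ge0; rewrite -(subKn le_k).
elim: (#|I| - k)%N (leq_subr k #|I|) => {k le_k} [|d IHd] le_d.
  exists setT; rewrite cardsT subn0; split=> //.
  by under eq_bigl do rewrite inE.
have [S [cardS sumS]] := IHd (ltnW le_d).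
have cardS' i : i \in S -> #|S :\ i| = (#|I| - d.+1)%N.
  by move=> iS; apply/eqP; rewrite subnS -cardS (cardsD1 i S) iS.
case: (pickP [pred i | (i \in S) && (g i <= 0)]) => [i /andP[iS gi]|gt0].
  exists (S :\ i); split; first exact: cardS'.
  move: sumS; rewrite (big_setD1 i iS) /= => sumS.
  by rewrite (le_trans sumS) // gerDr.
have [i iS] : exists i, i \in S.
  by apply/set0Pn; rewrite -card_gt0 cardS subn_gt0.
exists (S :\ i); split; first exact: cardS'.
apply: sumr_ge0 => j; rewrite !inE => /andP[_ jS].
by have := gt0 j; rewrite /= jS /= => /negbT; rewrite -ltNge => /ltW.
Qed.

(** Inverting [1 - x <= expR (- x)] gives [expR x <= 1 / (1 - x)], while the claimed bound times
    [1 - x] is [1 + x ^+ 2 * (1 - 2 * x)], at least 1. *)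
Lemma expR_quadratic_bound (R : realType) (x : R) :
  x <= 1 / 2 -> expR x <= 1 + x + 2 * x ^+ 2.
Proof.
move=> hx; have := expR_ge1Dx (- x); rewrite expRN => h.
have x1 : 0 < 1 - x by lra.
have e0 := expR_gt0 x.
have h1 : expR x * (1 - x) <= 1 by rewrite -ler_pdivlMl // mulr1.
rewrite -(ler_pM2r x1) (le_trans h1) //.
have -> : (1 + x + 2 * x ^+ 2) * (1 - x) = 1 + x ^+ 2 * (1 - 2 * x).
  by rewrite !expr2; ring.
by rewrite lerDl mulr_ge0 ?sqr_ge0 //; lra.
Qed.

Lemma ln_ge_half (R : realType) (x : R) : 2 <= x -> 1 / 2 <= ln x.
Proof.
move=> x2; have x0 : 0 < x by lra.
rewrite -ler_expR lnK ?posrE // (le_trans _ x2) //.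
have := expR_ge1Dx (- (1 / 2) : R); rewrite expRN => h.
have e0 := expR_gt0 (1 / 2 : R).
have h1 : expR (1 / 2 : R) * (1 - 1 / 2) <= 1 by rewrite -ler_pdivlMl // mulr1.
by lra.
Qed.

(** Provides the vote that ranks [x] first and [w] last. *)
Lemma perm_send2 (T : finType) (x w i j : T) :
  x != w -> i != j -> exists u : {perm T}, u x = i /\ u w = j.
Proof.
move=> nxw nij; exists (tperm x i * tperm (tperm x i w) j)%g.
rewrite !permM tpermL; split; last by rewrite tpermL.
rewrite tpermD // 1?eq_sym // -{1}(tpermL x i) inj_eq //.
exact: perm_inj.
Qed.

(** * Margin of victory and the lead of the winner *)

Lemma margin_of_victory_le (R : realType) (n m : nat) (a : 'rV[R]_m)
    (tb : profile n m -> {set 'I_m} -> 'I_m) (P Q : profile n m) :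
  winner a tb Q != winner a tb P ->
  (margin_of_victory a tb P <= changed_votes P Q)%N.
Proof.
move=> nw; rewrite /margin_of_victory.
by rewrite -leEnat -minEnat; apply: bigmin_le_cond.
Qed.

Lemma margin_of_victory_le_n (R : realType) (n m : nat) (a : 'rV[R]_m)
    (tb : profile n m -> {set 'I_m} -> 'I_m) (P : profile n m) :
  (margin_of_victory a tb P <= n)%N.
Proof.
by rewrite /margin_of_victory; elim/big_rec: _ => // Q k _; rewrite geq_min => ->;
  rewrite orbT.
Qed.

Lemma score_le_winner (R : realType) (n m : nat) (a : 'rV[R]_m)
    (tb : profile n m -> {set 'I_m} -> 'I_m) (P : profile n m) (d : 'I_m) :
  tie_breaking_rule tb -> score a P d <= score a P (winner a tb P).
Proof.
move=> tbP; suff /(tbP P) : top_scorers a P != set0.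
  by rewrite inE => /forallP /(_ d).
apply/set0Pn; case: (arg_maxP (score a P) (isT : xpredT d)) => c _ max_c.
by exists c; rewrite inE; apply/forallP => e; apply: max_c.
Qed.

Lemma winner_gap (R : realType) (n m : nat) (a : 'rV[R]_m)
    (tb : profile n m -> {set 'I_m} -> 'I_m) (P : profile n m)
    (i0 j0 x : 'I_m) :
  tie_breaking_rule tb -> a ord0 j0 < a ord0 i0 -> x != winner a tb P ->
  ((margin_of_victory a tb P)%:R - 1) * (a ord0 i0 - a ord0 j0) <=
    score a P (winner a tb P) - score a P x.
Proof.
move=> tbP aij nxw; set w := winner a tb P in nxw *.
set M := margin_of_victory a tb P; set D := _ - a ord0 j0.
have D0 : 0 < D by rewrite subr_gt0.
have gap0 : 0 <= score a P w - score a P x by rewrite subr_ge0 score_le_winner.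
(* The case [M = 0] is apart because [M.-1] is then 0 and not -1. *)
have [M0|M0] := posnP M.
  by rewrite M0 sub0r mulN1r (le_trans _ gap0) // oppr_le0 ltW.
have -> : M%:R - 1 = M.-1%:R :> R by rewrite -[in LHS](prednK M0) -natr1 addrK.
rewrite leNgt; apply/negP => small_gap.
have [S [cardS sumS]] : exists S : {set 'I_n},
    #|S| = M.-1 /\ 0 <= \sum_(i in S) (a ord0 (P i w) - a ord0 (P i x)).
  apply: nonneg_subset_sum; last by rewrite sumrB.
  by rewrite card_ord (leq_trans (leq_pred _)) ?margin_of_victory_le_n.
have nij : i0 != j0 by apply: contraTneq aij => ->; rewrite ltxx.
have [u [ux uw]] := perm_send2 nxw nij.
pose Q : profile n m := [ffun i => if i \in S then u else P i].
(* Votes outside [S] keep their contribution to the gap; each vote in [S] now contributes [- D]. As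
   the old sum over [S] is nonnegative, the new gap is negative. *)
have gapQ : score a Q w - score a Q x = score a P w - score a P x
    - \sum_(i in S) (a ord0 (P i w) - a ord0 (P i x)) - M.-1%:R * D.
  rewrite -!sumrB (bigID (mem S)) /= [in RHS](bigID (mem S)) /=.
  rewrite [X in _ = X - _ - _]addrC addrK addrC; congr (_ + _).
    by apply: eq_bigr => i /negbTE iS; rewrite ffunE iS.
  rewrite (eq_bigr (fun=> - D)) => [|i iS]; last by rewrite ffunE iS ux uw opprB.
  by rewrite sumr_const cardS mulNrn mulr_natl.
have nwQ : winner a tb Q != w.
  apply/eqP => wQ; have := score_le_winner a Q x tbP; rewrite wQ -subr_ge0 gapQ.
  by apply/negP; rewrite -ltNge; lra.
have := margin_of_victory_le nwQ.
(* [Q] differs from [P] only inside [S], so fewer than [M] changed votes dethrone [w]. *)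
rewrite -/M leqNgt => /negP; apply; rewrite -(prednK M0) ltnS -cardS.
apply: subset_leq_card; apply/subsetP => i; rewrite inE ffunE.
by case: (i \in S) => //; rewrite eqxx.
Qed.

(** * The two query algorithms and the sampling error *)

(** [Q] accumulates the answers; its initial value is irrelevant once [s] lists all voters. *)
Fixpoint query_all (n m : nat) (f : profile n m -> 'I_m) (s : seq 'I_n)
    (Q : profile n m) : algorithm n m :=
  if s is i :: s' then
    Query i (fun v => query_all f s' [ffun j => if j == i then v else Q j])
  else @Output n m (f Q).

Lemma output_prob_query_all (R : realType) (n m : nat)
    (f : profile n m -> 'I_m) (s : seq 'I_n) (P Q : profile n m) :
  (forall j, j \notin s -> Q j = P j) ->
  output_prob R (query_all f s Q) P (f P) = 1.
Proof.
elim: s Q => [|i s IHs] Q PQ /=.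
  by have -> : Q = P; [apply/ffunP => j; apply: PQ | rewrite eqxx].
apply: IHs => j js; rewrite ffunE; case: eqVneq => [-> //|nji].
by apply: PQ; rewrite inE negb_or nji.
Qed.

Lemma queries_query_all (n m : nat) (f : profile n m -> 'I_m) (s : seq 'I_n)
    (P Q : profile n m) :
  queries (query_all f s Q) P = size s.
Proof. by elim: s Q => //= i s IHs Q; rewrite IHs. Qed.

(** With [n.+1] voters, a draw from ['I_n.+1] is a uniform voter; [s] collects the votes read, with
    repetitions. *)
Fixpoint sample_votes (n m : nat) (best : seq (vote m) -> 'I_m) (l : nat)
    (s : seq (vote m)) : algorithm n.+1 m :=
  if l is l'.+1 then
    Draw (fun j : 'I_n.+1 => Query j (fun v => sample_votes n best l' (v :: s)))
  else @Output n.+1 m (best s).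

Lemma queries_sample_votes (n m : nat) (best : seq (vote m) -> 'I_m) (l : nat)
    (s : seq (vote m)) (P : profile n.+1 m) :
  (queries (sample_votes n best l s) P <= l)%N.
Proof.
elim: l s => //= l IHl s; apply/bigmax_leqP => j _; rewrite ltnS; exact: IHl.
Qed.

(* Markov's inequality for the exponential moments, unfolded along the draws:
   the bound on the error probability is a supermartingale. *)
Lemma sample_votes_error (R : realType) (n m : nat)
    (best : seq (vote m) -> 'I_m) (L : 'I_m -> vote m -> R) (q : R)
    (P : profile n.+1 m) (w : 'I_m) (l : nat) (s : seq (vote m)) :
  (forall s, best s != w -> 0 <= \sum_(v <- s) L (best s) v) ->
  (forall x, x != w -> (\sum_j expR (L x (P j))) / n.+1%:R <= q) ->
  1 - output_prob R (sample_votes n best l s) P w <=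
    \sum_(x | x != w) q ^+ l * expR (\sum_(v <- s) L x v).
Proof.
move=> bestP qP; elim: l s => [|l IHl] s /=.
  have [_|nw] := eqVneq (best s) w.
    by rewrite subrr sumr_ge0 // => x _; rewrite mul1r expR_ge0.
  (* The error is 1 here, and the summand of the wrong output [best s] alone is at least 1. *)
  rewrite subr0 (bigD1 (best s) nw) /= mul1r.
  rewrite (le_trans (y := expR (\sum_(v <- s) L (best s) v))) //.
    by rewrite -expR0 ler_expR bestP.
  by rewrite lerDl sumr_ge0 // => x _; rewrite mul1r expR_ge0.
have N0 : 0 < n.+1%:R :> R by rewrite ltr0n.
have -> : 1 - (\sum_j output_prob R (sample_votes n best l (P j :: s)) P w)
      / n.+1%:R =
    (\sum_j (1 - output_prob R (sample_votes n best l (P j :: s)) P w))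
      / n.+1%:R.
  by rewrite sumrB sumr_const card_ord mulrBl divff ?gt_eqF.
rewrite ler_pdivrMr // (le_trans (ler_sum _ (fun j _ => IHl (P j :: s)))) //.
rewrite exchange_big /= mulr_suml; apply: ler_sum => x nxw.
have q0 : 0 <= q.
  by rewrite (le_trans _ (qP x nxw)) // divr_ge0 // sumr_ge0 // => j _;
    rewrite expR_ge0.
(* One more draw multiplies the term of [x] by [expR (L x (P j))], whose average over [j] is at most
   [q]. *)
under eq_bigr do rewrite big_cons expRD.
rewrite -mulr_sumr -mulr_suml exprSr -!mulrA ler_wpM2l ?exprn_ge0 //.
by rewrite [leRHS]mulrCA [leLHS]mulrC ler_wpM2l ?expR_ge0 // -ler_pdivrMr ?qP.
Qed.

(** For a rate [t], the quadratic bound gives a mean of at most [1 - t * eps / 2 + 2 * t ^+ 2]. This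
    is smallest at [t = eps / 8], with value [1 - eps ^+ 2 / 32]. *)
Lemma expR_loss_mean (R : realType) (n : nat) (Y : 'I_n.+1 -> R) (eps : R) :
  0 < eps <= 1 -> (forall j, -1 <= Y j <= 1) ->
  eps / 2 <= (\sum_j Y j) / n.+1%:R ->
  (\sum_j expR (- (eps / 8) * Y j)) / n.+1%:R <= expR (- (eps ^+ 2 / 32)).
Proof.
move=> /andP[eps0 eps1] Y1 meanY.
have N0 : 0 < n.+1%:R :> R by rewrite ltr0n.
have bound j : expR (- (eps / 8) * Y j) <=
    (1 + eps ^+ 2 / 32) - eps / 8 * Y j.
  have /andP[Y0 Y1j] := Y1 j.
  apply: le_trans (expR_quadratic_bound _) _; first by nra.
  have Y2 : Y j ^+ 2 <= 1 by nra.
  have := ler_wpM2l (sqr_ge0 eps) Y2.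
  by rewrite exprMn sqrrN expr_div_n; nra.
have h : (\sum_j expR (- (eps / 8) * Y j)) / n.+1%:R <=
    1 + eps ^+ 2 / 32 - eps / 8 * ((\sum_j Y j) / n.+1%:R).
  rewrite ler_pdivrMr // (le_trans (ler_sum _ (fun j _ => bound j))) //.
  rewrite sumrB sumr_const card_ord -mulr_sumr [leRHS]mulrBl.
  by rewrite -[X in _ <= _ - X]mulrA divfK ?gt_eqF // mulr_natr.
rewrite (le_trans h) // (le_trans _ (expR_ge1Dx _)) //.
have := ler_wpM2l (ltW eps0) meanY.
move: (_ / n.+1%:R) => mu; rewrite expr2; lra.
Qed.

(** * Chernoff and union bounds, then the choice of algorithm *)

Lemma sample_votes_solves (R : realType) (n m : nat) (a : 'rV[R]_m)
    (tb : profile n.+1 m -> {set 'I_m} -> 'I_m) (c0 i0 j0 : 'I_m)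
    (eps delta : R) (l : nat) :
  tie_breaking_rule tb -> a ord0 j0 < a ord0 i0 ->
  (forall i, a ord0 j0 <= a ord0 i <= a ord0 i0) ->
  0 < eps <= 1 -> 0 < delta -> 2 < eps * n.+1%:R ->
  32 * ln (m%:R / delta) / eps ^+ 2 <= l%:R ->
  solves_winner_determination a tb eps delta
    (sample_votes n (fun s => [arg max_(c > c0) \sum_(v <- s) a ord0 (v c)]%O)
       l [::]).
Proof.
move=> tbP aij a_bounds /andP[eps0 eps1] delta0 n_large l_large P movP.
set w := winner a tb P; set best := fun s => _.
pose D := a ord0 i0 - a ord0 j0.
have D0 : 0 < D by rewrite subr_gt0.
pose Y x (v : vote m) := (a ord0 (v w) - a ord0 (v x)) / D.
(* The sample maximizer scores at least as much as [w] on the sample, so its total lead deficit [Y]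
   is nonpositive. *)
have bestP s : best s != w ->
    0 <= \sum_(v <- s) - (eps / 8) * Y (best s) v.
  move=> _; rewrite -mulr_sumr -mulr_suml sumrB mulNr oppr_ge0.
  rewrite pmulr_rle0 ?divr_gt0 // pmulr_lle0 ?invr_gt0 // subr_le0.
  by rewrite /best; case: arg_maxP => // c _; apply.
have m0 : 0 < m%:R :> R by rewrite ltr0n (leq_ltn_trans _ (ltn_ord c0)).
have meanP x : x != w -> (\sum_j expR (- (eps / 8) * Y x (P j))) / n.+1%:R <=
    expR (- (eps ^+ 2 / 32)).
  move=> nxw; apply: expR_loss_mean; first by rewrite eps0.
    move=> j; rewrite /Y ler_pdivlMr // ler_pdivrMr // /D.
    have /andP[? ?] := a_bounds (P j w); have /andP[? ?] := a_bounds (P j x).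
    by apply/andP; split; lra.
  rewrite ler_pdivlMr ?ltr0n // /Y -mulr_suml sumrB ler_pdivlMr //.
  apply: le_trans (winner_gap tbP aij nxw).
  (* Since [eps * n.+1%:R > 2], subtracting 1 from the margin costs at most half of
     [eps * n.+1%:R]. *)
  by rewrite ler_wpM2r ?ltW // -/D; lra.
have := @sample_votes_error _ _ _ best (fun x v => - (eps / 8) * Y x v) _ _ _ l
  [::] bestP meanP.
under eq_bigr do rewrite big_nil expR0 mulr1.
rewrite -expRM_natl lerBlDr -lerBlDl => /(le_trans _); apply.
(* Union bound: at most [m] rivals, each contributing at most [delta / m%:R] by the choice of
   [l]. *)
rewrite lerD2l lerN2 (le_trans (y := m%:R * expR (- ln (m%:R / delta)))) //.
  rewrite sumr_const -[leLHS]mulr_natl ler_pM ?ler0n ?expR_ge0 //.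
    by rewrite ler_nat (leq_trans (max_card _)) ?card_ord.
  rewrite ler_expR mulrN lerN2.
  by move: l_large; rewrite ler_pdivrMr ?exprn_gt0 //; lra.
by rewrite expRN lnK ?posrE ?divr_gt0 // invf_div mulrC divfK ?gt_eqF.
Qed.

Theorem theorem6 (R : realType) :
  exists C : R, 0 < C /\
    forall (m : nat) (a : 'rV[R]_m), score_vector a -> normalized a ->
    forall (n : nat) (tb : profile n m -> {set 'I_m} -> 'I_m),
      tie_breaking_rule tb ->
    forall eps delta : R, 0 < eps -> 0 < delta < 1 ->
    exists A : algorithm n m,
      solves_winner_determination a tb eps delta A /\
      (sample_complexity A)%:R <= C * (ln (m%:R / delta) / eps ^+ 2).
Proof.
(* 32 comes from the Chernoff exponent; the other 2 absorb the rounding of the sample size, as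
   [1 <= 2 * B] when [eps <= 1]. *)
exists 34; split=> // m a [a_mono [i0 [j0 [i00 j0m aij]]]] _ n tb tbP eps delta.
move=> eps0 /andP[delta0 delta1].
have m_gt1 : (1 < m)%N.
  have /eqP nij : (i0 != j0 :> nat).
    by apply: contraTneq aij => /val_inj ->; rewrite ltxx.
  by move: nij; rewrite i00 j0m; case: (m) => [|[]].
have L_ge : 1 / 2 <= ln (m%:R / delta) :> R.
  apply: ln_ge_half; rewrite ler_pdivlMr // (le_trans (y := 2)) ?ler_nat //.
  by rewrite ger_pMr // ltW.
set L := ln _ in L_ge *; set B := L / eps ^+ 2.
have B0 : 0 <= 34 * B by rewrite mulr_ge0 // divr_ge0 ?sqr_ge0 //; lra.
have all_solves : solves_winner_determination a tb eps delta
    (query_all (winner a tb) (enum 'I_n) [ffun=> 1%g]).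
  move=> P _; rewrite output_prob_query_all; last by move=> j; rewrite mem_enum.
  by rewrite gerBl ltW.
have all_complexity :
    (sample_complexity (query_all (winner a tb) (enum 'I_n) [ffun=> 1%g]) <= n)%N.
  by apply/bigmax_leqP => P _; rewrite queries_query_all size_enum_ord.
case: n => [|n] in tb tbP all_solves all_complexity *.
  exists (query_all (winner a tb) (enum 'I_0) [ffun=> 1%g]); split=> //.
  by move: all_complexity; rewrite leqn0 => /eqP ->.
(* For [eps > 1] no profile meets the promise, the margin being at most the number of voters, so a
   constant output suffices. *)
have [eps1|eps1] := ltP 1 eps.
  exists (@Output n.+1 m i0); split.
    move=> P /le_trans /(_ (_ : _ <= n.+1%:R)).
    rewrite ler_nat margin_of_victory_le_n => /(_ isT).
    by rewrite ger_pMl ?ltr0n // leNgt eps1.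
  by rewrite /sample_complexity big1.
have B_ge : 1 / 2 <= B.
  by rewrite ler_pdivlMr ?exprn_gt0 //; nra.
have [n_small|n_large] := leP (eps * n.+1%:R) 2.
  exists (query_all (winner a tb) (enum 'I_n.+1) [ffun=> 1%g]); split=> //.
  apply: le_trans (_ : n.+1%:R <= _); first by rewrite ler_nat.
  (* Here [eps ^+ 2 * n.+1%:R <= 2 * eps <= 2], below [34 * L] because [L >= 1 / 2]. *)
  rewrite /B mulrA ler_pdivlMr ?exprn_gt0 //.
  have := ler_wpM2l (ltW eps0) n_small.
  by rewrite expr2; lra.
pose l := (Num.trunc (32 * B)).+1.
have l_gt : 32 * B < l%:R by exact: truncnS_gt.
have l_le : l%:R <= 32 * B + 1.
  by rewrite -[leLHS]natr1 lerD2r truncn_le; lra.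
exists (sample_votes n
  (fun s => [arg max_(c > i0) \sum_(v <- s) a ord0 (v c)]%O) l [::]); split.
  apply: (sample_votes_solves i0 tbP aij) => //; last by rewrite -mulrA ltW.
    move=> i; rewrite !a_mono ?i00 // j0m -ltnS prednK ?ltn_ord //.
    exact: ltnW.
  by rewrite eps0.
apply: le_trans (_ : l%:R <= _); last by lra.
rewrite ler_nat; apply/bigmax_leqP => P _; exact: queries_sample_votes.
Qed.
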